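(* Let $G$ be a connected graph of order at least 3. Then $G$ is a minimal DPDP-graph if and only if $G=S_2(H)$ for some connected graph $H$ (and some function $\alpha$), and either $(V^o_{S_2(H)},V^n_{S_2(H)})$ is the only DP-pair in $S_2(H)$, or $S_2(H)$ is a cycle of length 3, 6 or 9.
   Context: Graphs are finite and may have multiple edges and loops. A leaf is a vertex of degree one. A set $D\subseteq V(G)$ is dominating if every vertex outside $D$ has a neighbor in $D$; $P$ is paired-dominating if it is dominating and the subgraph induced by $P$ has a perfect matching. A DP-pair of $G$ is a pair $(D,P)$ of disjoint sets with $V(G)=D\cup P$, $D$ dominating and $P$ paired-dominating. A DPDP-graph is a graph with a DP-pair; a minimal DPDP-graph is a DPDP-graph no proper spanning subgraph of which is a DPDP-graph. 2-subdivision graph: for a graph $H$ with no isolated vertex, set of leaves $L_H$, and $\alpha:L_H\to\mathbb{N}=\{1,2,\dots\}$, $S_2(H)$ has vertex set $V^o_{S_2(H)}\cup V^n_{S_2(H)}$ where $V^o_{S_2(H)}=(V_H\setminus L_H)\cup\{(v,i): v\in L_H, 1\le i\le \alpha(v)\}$ and $V^n_{S_2(H)}$ consists of two new vertices for each edge $e$ of $H$ ($u_e,v_e$ if $e$ joins $u\ne v$; $v_e^1,v_e^2$ if $e$ is a loop at $v$). Its edges are: the edge joining the two new vertices of each $e$; for $v\in V_H\setminus L_H$, $vv_e$ for each non-loop edge $e$ at $v$ and $vv_e^1,vv_e^2$ for each loop $e$ at $v$; for $v\in L_H$ with incident edge $e$, the edges $v_e(v,i)$, $1\le i\le\alpha(v)$.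 *)

(* Defs.v *)
From HB Require Import structures.
From mathcomp Require Import all_boot.
Set Implicit Arguments. Unset Strict Implicit. Unset Printing Implicit Defensive.

(* Finite multigraphs (multiple edges and loops allowed): a finite vertex
   type, a finite edge type, and an endpoint pair for each edge.  An edge e
   with (endpts e).1 = (endpts e).2 is a loop.  Orientation of the pair is
   irrelevant for all notions below. *)
Record mgraph := MGraph {
  vert : finType;
  edge : finType;
  endpts : edge -> vert * vert }.

Section Basics.
Variable G : mgraph.

Definition incident (e : edge G) (v : vert G) : bool :=
  ((endpts e).1 == v) || ((endpts e).2 == v).

(* degree: a loop contributes 2 *)
Definition deg (v : vert G) : nat :=
  #|[set e : edge G | (endpts e).1 == v]| + #|[set e : edge G | (endpts e).2 == v]|.

Definition leaf (v : vert G) : bool := deg v == 1.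

Definition no_isolated : Prop := forall v : vert G, deg v != 0.

Definition adj : rel (vert G) := fun u v =>
  [exists e : edge G, (endpts e == (u, v)) || (endpts e == (v, u))].

Definition connected : Prop := forall u v : vert G, connect adj u v.

Definition dominating (D : {set vert G}) : Prop :=
  forall v, v \notin D -> exists2 u, u \in D & adj v u.

Definition has_perfect_matching_on (P : {set vert G}) : Prop :=
  exists M : {set edge G},
    (forall e, e \in M ->
       [/\ (endpts e).1 != (endpts e).2, (endpts e).1 \in P & (endpts e).2 \in P])
    /\ (forall v, v \in P -> #|[set e in M | incident e v]| = 1).

Definition paired_dominating (P : {set vert G}) : Prop :=
  dominating P /\ has_perfect_matching_on P.

Definition DP_pair (D P : {set vert G}) : Prop :=
  [/\ [disjoint D & P], D :|: P = [set: vert G], dominating D & paired_dominating P].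

Definition DPDP : Prop := exists D P, DP_pair D P.

End Basics.

Definition restrict (G : mgraph) (F : {set edge G}) : mgraph :=
  @MGraph (vert G) {e : edge G | e \in F} (fun e => endpts (val e)).

Definition minimal_DPDP (G : mgraph) : Prop :=
  DPDP G /\ forall F : {set edge G}, F \proper [set: edge G] -> ~ DPDP (restrict F).

Definition iso (G1 G2 : mgraph) : Prop :=
  exists (f : vert G1 -> vert G2) (g : edge G1 -> edge G2),
    [/\ bijective f, bijective g &
        forall e, endpts (g e) = (f (endpts e).1, f (endpts e).2)
               \/ endpts (g e) = (f (endpts e).2, f (endpts e).1)].

Definition cycle_graph (n : nat) : mgraph :=
  @MGraph 'I_n 'I_n (fun i => (i, ordS i)).

Section S2.
Variables (H : mgraph) (alpha : vert H -> nat).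

Definition endside (e : edge H) (b : bool) : vert H :=
  if b then (endpts e).1 else (endpts e).2.

(* old vertices: non-leaves of H, and copies (v,i), i < alpha v, of leaves v
   (copies indexed 0..alpha v - 1 instead of 1..alpha v) *)
Definition NLvert := {v : vert H | ~~ leaf v}.
Definition LCvert := {v : {v : vert H | leaf v} & 'I_(alpha (val v))}.
Definition OldV := (NLvert + LCvert)%type.
(* new vertices: (e,true) and (e,false) for each edge e; for a non-loop
   e = uv with endpts e = (u,v) these are u_e and v_e, for a loop they are
   v_e^1 and v_e^2 *)
Definition NewV := (edge H * bool)%type.
Definition S2V := (OldV + NewV)%type.

(* edges: middle edge of each e; v -- v_e for each incidence (e,b) at a
   non-leaf v; (v,i) -- v_e for each leaf copy and the incidence at v *)
Definition E2 := {x : edge H * bool | ~~ leaf (endside x.1 x.2)}.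
Definition E3 := {p : LCvert * (edge H * bool) | endside p.2.1 p.2.2 == val (tag p.1)}.
Definition S2E := (edge H + (E2 + E3))%type.

Definition S2_ends (x : S2E) : S2V * S2V :=
  match x with
  | inl e => (inr (e, true), inr (e, false))
  | inr (inl (exist y hy)) => (inl (inl (exist _ (endside y.1 y.2) hy)), inr y)
  | inr (inr p) => (inl (inr (val p).1), inr (val p).2)
  end.

Definition S2 : mgraph := @MGraph S2V S2E S2_ends.

Definition S2_old : {set vert S2} := [set x : vert S2 | if x is inl _ then true else false].
Definition S2_new : {set vert S2} := [set x : vert S2 | if x is inr _ then true else false].

End S2.

(* Main.v *)
Require Import Defs.
From mathcomp Require Import all_boot zify.
Set Implicit Arguments. Unset Strict Implicit. Unset Printing Implicit Defensive.

(* In a minimal DPDP-graph with DP-pair (D, P), every edge belongs to the perfect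
   matching M of P or to a forest of stars joining D to P; contracting the stars
   gives H, whose edges are those of M.  If two DP-pairs (D, P) and (D', P') have
   D and D' meeting, then the agreement spreads along edges and the pairs
   coincide.  If D and D' are disjoint, no vertex can be pendant, so each star is
   centred in D, all vertices of P have degree 2, and so, exchanging the pairs,
   do all others: the graph is a cycle.  Counting edges, its length is 3|M|, and
   for length at least 12 some DP-pair has an edge inside its first component.
   Conversely every edge of S_2(H) is needed by the canonical pair, and a cycle of
   length 3, 6 or 9 has too few edges to lose one. *)

(** * Incidence, DP-pairs and their transport *)

Lemma inj_surj_bij (A B : finType) (f : A -> B) :
  injective f -> (forall y, exists x, f x = y) -> bijective f.
Proof.
move=> injf surjf; have cf y : y \in codom f.
  by have [x <-] := surjf y; apply: codom_f.
by exists (fun y => iinv (cf y)) => [x | y]; rewrite ?f_iinv //; apply: injf; rewrite f_iinv.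
Qed.

Section Incidence.
Variable G : mgraph.
Implicit Types (D P : {set vert G}) (M F : {set edge G}) (e : edge G) (v : vert G).

Definition inc F v : {set edge G} := [set e in F | incident e v].
(** The end of [e] other than [v], which is [v] itself for a loop; meaningful only when [e] is
    incident to [v]. *)
Definition opp e v : vert G := if (endpts e).1 == v then (endpts e).2 else (endpts e).1.
Definition cross D : {set edge G} :=
  [set e | ((endpts e).1 \in D) (+) ((endpts e).2 \in D)].

Lemma incident1 e : incident e (endpts e).1.
Proof. by rewrite /incident eqxx. Qed.

Lemma incident2 e : incident e (endpts e).2.
Proof. by rewrite /incident eqxx orbT. Qed.

Lemma incident_opp e v : incident e v -> incident e (opp e v).
Proof. by rewrite /incident /opp; case: eqP => _; rewrite eqxx ?orbT. Qed.

Lemma oppK e v : incident e v -> opp e (opp e v) = v.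
Proof.
rewrite /incident /opp; have [<- _|_ /= /eqP <-] := eqVneq (endpts e).1 v.
  by case: eqP.
by rewrite eqxx.
Qed.

Lemma incidentE e v u : incident e v -> incident e u = (u == v) || (u == opp e v).
Proof.
rewrite /incident /opp; have [<- _|ne /= /eqP <-] := eqVneq (endpts e).1 v.
  by rewrite !(eq_sym u).
by rewrite !(eq_sym u) orbC.
Qed.

Lemma in_cross D e v : incident e v -> (e \in cross D) = (v \in D) (+) (opp e v \in D).
Proof.
rewrite inE /incident /opp; have [<- //|ne /= /eqP <-] := eqVneq (endpts e).1 v.
by rewrite addbC.
Qed.

Lemma adjP u v : reflect (exists2 e, incident e u & opp e u = v) (adj u v).
Proof.
apply: (iffP existsP) => -[e].
  case/orP=> /eqP eE; exists e; rewrite /incident /opp eE /= ?eqxx ?orbT //.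
  by case: eqP.
rewrite /incident /opp => ieu <-; exists e.
by move: ieu; case: (endpts e) => a b /=; have [<-|_ /= /eqP->] := eqVneq a u;
  rewrite ?eqxx ?orbT.
Qed.

Lemma in_inc F v e : (e \in inc F v) = (e \in F) && incident e v.
Proof. by rewrite inE. Qed.

Lemma inc1_mem F v e : inc F v = [set e] -> e \in F /\ incident e v.
Proof. by move=> Fe; apply/andP; have := set11 e; rewrite -Fe inE. Qed.

(* Domination by both [D] and its complement amounts to saying that every
   vertex has an edge leaving its own class. *)
Record DPset D M : Prop := DPsetI {
  DPset_loopless : forall e, e \in M -> (endpts e).1 != (endpts e).2;
  DPset_outside : forall e v, e \in M -> incident e v -> v \notin D;
  DPset_matched : forall v, v \notin D -> #|inc M v| = 1;
  DPset_cross : forall v, inc (cross D) v != set0 }.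

Lemma DP_pairP D P : DP_pair D P <-> P = ~: D /\ exists M, DPset D M.
Proof.
split=> [[dDP DP domD [domP [M [MP M1]]]] | [-> [M [loopM outM M1 cD]]]].
  have PE : P = ~: D.
    apply/setP=> v; move/setP/(_ v): DP; rewrite !inE.
    have [vD _|//] := boolP (v \in D).
    by rewrite (disjointFr dDP vD).
  subst P; split=> //; exists M; split.
  - by move=> e /MP[].
  - by move=> e v /MP[_]; rewrite !inE /incident => h1 h2 /orP[]/eqP<-.
  - by move=> v vD; apply: M1; rewrite inE.
  move=> v; apply/set0Pn; have [vD|vD] := boolP (v \in D).
    have [|u uP /adjP[e ev oe]] := domP v; first by rewrite inE vD.
    by exists e; rewrite inE ev (in_cross _ ev) oe vD andbT; rewrite inE in uP; rewrite addTb.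
  have [u uD /adjP[e ev oe]] := domD v vD.
  by exists e; rewrite inE ev (in_cross _ ev) oe (negbTE vD) uD.
have nb v : exists2 u, (u \in D) = (v \notin D) & adj v u.
  have /set0Pn[e] := cD v; rewrite inE => /andP[eD ev].
  exists (opp e v); last by apply/adjP; exists e.
  by move: eD; rewrite (in_cross _ ev); case: (v \in D); case: (opp e v \in D).
split.
- by rewrite -setI_eq0 setICr.
- by rewrite setUCr.
- by move=> v vD; have [u uD vu] := nb v; exists u; rewrite // uD.
split=> [v|]; first by rewrite inE negbK => vD; have [u uD vu] := nb v; exists u; rewrite // inE uD vD.
exists M; split=> [e eM|v]; last by rewrite inE; apply: M1.
by rewrite !inE loopM // !(outM e) ?incident1 ?incident2.
Qed.

End Incidence.

(** The edge map is arbitrary, so that inclusions of spanning subgraphs are covered as well as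
    isomorphisms: further edges of [G2] can only enlarge the cut. *)
Lemma DPset_hom (G1 G2 : mgraph) (f : vert G1 -> vert G2) (g : edge G1 -> edge G2)
    (D : {set vert G1}) (M : {set edge G1}) :
  bijective f ->
  (forall e, endpts (g e) = (f (endpts e).1, f (endpts e).2) \/
             endpts (g e) = (f (endpts e).2, f (endpts e).1)) ->
  DPset D M -> DPset (f @: D) (g @: M).
Proof.
move=> bijf fg [loopM outM M1 cD]; have injf := bij_inj bijf.
have incg e v : incident (g e) (f v) = incident e v.
  by rewrite /incident; case: (fg e) => -> /=; rewrite !(inj_eq injf) // orbC.
have crg e : (g e \in cross (f @: D)) = (e \in cross D).
  by rewrite !inE; case: (fg e) => -> /=; rewrite !(mem_imset _ _ injf) // addbC.
split.
- move=> _ /imsetP[e eM ->]; case: (fg e) => -> /=; rewrite (inj_eq injf).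
    exact: loopM.
  by rewrite eq_sym; apply: loopM.
- move=> _ v /imsetP[e eM ->]; have [f' _ f'K] := bijf.
  by rewrite -(f'K v) incg mem_imset //; apply: outM.
- move=> v; have [f' _ f'K] := bijf; rewrite -(f'K v) mem_imset // => /M1/eqP/cards1P[e Me].
  have [eM ev] := inc1_mem Me.
  apply/eqP/cards1P; exists (g e); apply/setP=> e'; rewrite !inE; apply/andP/eqP.
    case=> /imsetP[e1 e1M ->]; rewrite incg => e1v; congr g; apply/set1P.
    by rewrite -Me inE e1M.
  by move=> ->; rewrite incg ev imset_f.
move=> v; have [f' _ f'K] := bijf; rewrite -(f'K v).
have /set0Pn[e] := cD (f' v); rewrite inE => /andP[ecD ev]; apply/set0Pn.
by exists (g e); rewrite inE crg ecD incg.
Qed.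

Lemma DPDP_hom (G1 G2 : mgraph) (f : vert G1 -> vert G2) (g : edge G1 -> edge G2) :
  bijective f ->
  (forall e, endpts (g e) = (f (endpts e).1, f (endpts e).2) \/
             endpts (g e) = (f (endpts e).2, f (endpts e).1)) ->
  DPDP G1 -> DPDP G2.
Proof.
move=> bijf fg [D [_ /DP_pairP[_ [M DM]]]].
exists (f @: D), (~: (f @: D)); apply/DP_pairP; split=> //.
by exists (g @: M); apply: DPset_hom.
Qed.

Lemma iso_sym G1 G2 : iso G1 G2 -> iso G2 G1.
Proof.
case=> f [g [[f' fK f'K] [g' gK g'K] fg]]; exists f', g'; split.
- by exists f.
- by exists g.
move=> e; have := fg (g' e); rewrite g'K => -[->|->] /=; rewrite !fK -surjective_pairing; auto.
Qed.

Lemma iso_trans G1 G2 G3 : iso G1 G2 -> iso G2 G3 -> iso G1 G3.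
Proof.
case=> f [g [bf bg fg]] [f' [g' [bf' bg' fg']]]; exists (f' \o f), (g' \o g).
split; [exact: bij_comp | exact: bij_comp | move=> e /=].
by case: (fg' (g e)) => ->; case: (fg e) => -> /=; auto.
Qed.

Lemma iso_connected G1 G2 : iso G1 G2 -> connected G1 -> connected G2.
Proof.
case=> f [g [[f' fK f'K] _ fg]] conG u v; rewrite -(f'K u) -(f'K v).
have /connectP[p] := conG (f' u) (f' v); elim: p (f' u) => [|x p IHp] w /=.
  by move=> _ ->.
case/andP=> /existsP[e ew] xp lp; apply: (connect_trans _ (IHp _ xp lp)).
apply/connect1/existsP; exists (g e).
by case: (fg e) => ->; case/orP: ew => /eqP-> /=; rewrite eqxx ?orbT.
Qed.

Lemma iso_minimal G1 G2 : iso G1 G2 -> minimal_DPDP G1 -> minimal_DPDP G2.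
Proof.
move=> i12 [dp1 min1]; split.
  by have [f [g [bf _ fg]]] := i12; apply: (DPDP_hom bf fg).
have [f [g [bf bg fg]]] := iso_sym i12.
move=> F pF dpF; apply: (min1 (g @: F)).
  rewrite properEcard subsetT cardsT (card_imset _ (bij_inj bg)).
  by rewrite -(bij_eq_card bg) -cardsT proper_card.
have gF (e : {e | e \in F}) : g (val e) \in g @: F by rewrite imset_f ?(valP e).
pose g' (e : edge (restrict F)) : edge (restrict (g @: F)) := exist _ (g (val e)) (gF e).
exact: (@DPDP_hom (restrict F) (restrict (g @: F)) f g' bf (fun e => fg (val e))).
Qed.

(** * Edges of a minimal DPDP-graph *)

Section Minimal.
Variables (G : mgraph) (minG : minimal_DPDP G).
Implicit Types (D : {set vert G}) (M F : {set edge G}) (e : edge G) (v : vert G).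

(** The pair given by [D] survives in the spanning subgraph with edge set [F], which minimality
    forbids for a proper [F]. *)
Lemma minimal_full D M F : DPset D M ->
  M \subset F -> (forall v, inc (cross D :&: F) v != set0) -> F = [set: edge G].
Proof.
case=> [loopM outM M1 _] MF cF; apply/eqP; apply: contraT => nF.
case: (minG.2 F); first by rewrite properEneq nF subsetT.
exists D, (~: D); apply/DP_pairP; split=> //.
exists [set e : edge (restrict F) | val e \in M]; split.
- by move=> e; rewrite inE; apply: loopM.
- by move=> e v; rewrite inE; apply: outM.
- move=> v /M1/eqP/cards1P[e Me]; have [eM ev] := inc1_mem Me.
  apply/eqP/cards1P; exists (exist _ e (subsetP MF e eM)); apply/setP=> e'.
  rewrite !inE -val_eqE /=; apply/andP/eqP => [[e'M e'v] | e'e].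
    by apply/set1P; rewrite -Me inE e'M.
  by split; [rewrite e'e | rewrite /incident /= e'e].
move=> v; have /set0Pn[e] := cF v; rewrite 3!inE => /andP[/andP[ec eF] ev].
by apply/set0Pn; exists (exist _ e eF); rewrite !inE ec.
Qed.

Lemma minimal_edgeP D M e : DPset D M -> (e \in M) || (e \in cross D).
Proof.
move=> DM; have /setP/(_ e) : M :|: cross D = setT; last by rewrite !inE.
apply: (minimal_full DM); first exact: subsetUl.
by move=> v; rewrite (setIidPl (subsetUr _ _)); apply: DPset_cross DM v.
Qed.

(* The crossing edges form a star forest. *)
Lemma minimal_star D M e v : DPset D M -> e \in cross D -> incident e v ->
  inc (cross D) v = [set e] \/ inc (cross D) (opp e v) = [set e].
Proof.
move=> DM ec ev.
(* Deleting [e] leaves the matching intact, so by minimality some [u] loses its last crossing edge;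
   that edge is [e], and [u] is one of its ends. *)
have [u /eqP ue] : exists u, inc (cross D :&: [set~ e]) u == set0.
  apply/existsP; apply: contraT; rewrite negb_exists => /forallP ne.
  have MF : M \subset [set~ e].
    apply/subsetP=> m mM; rewrite !inE; apply: contraTneq ec => <-.
    by rewrite (in_cross _ (incident1 _)) !(negbTE (DPset_outside DM mM _)) ?incident1
      ?incident_opp ?incident1.
  by have /setP/(_ e) := minimal_full DM MF ne; rewrite !inE eqxx.
have cu : inc (cross D) u = [set e].
  apply/eqP; rewrite eqEsubset sub1set; have sub : inc (cross D) u \subset [set e].
    apply/subsetP=> x xu; move/setP/(_ x): ue; move: xu; rewrite !in_inc in_setI in_set0.
    by case/andP=> -> ->; rewrite andbT in_setC => /negbFE.
  rewrite sub /=; have /set0Pn[x xu] := DPset_cross DM u.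
  by have /set1P <- := subsetP sub x xu.
have [_] := inc1_mem cu; rewrite (incidentE _ ev) => /orP[]/eqP<-; auto.
Qed.

End Minimal.

(** * Two DP-pairs of a minimal graph *)

Section TwoPairs.
Variables (G : mgraph) (minG : minimal_DPDP G).
Implicit Types (D : {set vert G}) (M F : {set edge G}) (e : edge G) (v : vert G).

Lemma matching_not_cross D M e : DPset D M -> e \in M -> e \notin cross D.
Proof.
move=> DM eM; rewrite (in_cross _ (incident1 e)).
by rewrite !(negbTE (DPset_outside DM eM _)) ?incident_opp ?incident1.
Qed.

Lemma cross_mem D M e v : DPset D M -> v \in D -> incident e v -> e \in cross D.
Proof.
move=> DM vD ev; have := minimal_edgeP minG e DM; case: (boolP (e \in M)) => //= eM _.
by have := DPset_outside DM eM ev; rewrite vD.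
Qed.

Lemma inc_cross D M v : DPset D M -> v \in D -> inc (cross D) v = inc setT v.
Proof.
move=> DM vD; apply/setP=> e; rewrite !in_inc in_setT.
by case: (boolP (incident e v)) => [ev|]; rewrite ?andbF // (cross_mem DM vD ev).
Qed.

(** A vertex outside [D] lies on a matching edge and on a crossing edge, and these differ. *)
Lemma pendant_mem D M v e : DPset D M -> inc setT v = [set e] -> v \in D.
Proof.
move=> DM Iv; apply: contraT => vD.
have /eqP/cards1P[m Mm] := DPset_matched DM vD; have [mM mv] := inc1_mem Mm.
have /set0Pn[c] := DPset_cross DM v; rewrite in_inc => /andP[cD cv].
have Ie x : incident x v -> x = e by move=> xv; apply/set1P; rewrite -Iv in_inc in_setT.
by have := matching_not_cross DM mM; rewrite (Ie m mv) -(Ie c cv) cD.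
Qed.

Section Compare.
Variables (D1 D2 : {set vert G}) (M1 M2 : {set edge G}).
Hypotheses (DM1 : DPset D1 M1) (DM2 : DPset D2 M2).

(** Two crossing edges at [v] make [v] the centre of its star, so [e'] is the only crossing edge at
    its end in [D1]. That end is then pendant in [G] and lies in the first set of every DP-pair. *)
Lemma opp_shared e e' v : v \notin D1 ->
  e \in cross D1 -> incident e v -> e' \in cross D1 -> incident e' v -> e' != e ->
  opp e' v \in D2.
Proof.
move=> vD eD ev e'D e'v ne; have ov : opp e' v \in D1.
  by move: e'D; rewrite (in_cross _ e'v) (negbTE vD).
case: (minimal_star minG DM1 e'D e'v) => [ce|].
  have : e \in [set e'] by rewrite -ce in_inc eD ev.
  by rewrite inE eq_sym (negbTE ne).
by rewrite (inc_cross DM1 ov) => /(pendant_mem DM2).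
Qed.

(* Invariant propagated along the edges of a connected graph once [D1] and [D2] meet. *)
Definition agree v : bool :=
  if v \in D1 then v \in D2
  else [&& v \notin D2, inc M1 v \subset M2 &
           [forall e in inc (cross D1) v, opp e v \in D2]].

Lemma agree_opp e v : incident e v -> agree v -> agree (opp e v).
Proof.
move=> ev; rewrite /agree; set y := opp e v.
have ey : incident e y := incident_opp ev.
have oy : opp e y = v := oppK ev.
case: (boolP (v \in D1)) => [vD1 vD2 | vD1 /and3P[vD2 Mv /forall_inP Cv]].
  have e1 := cross_mem DM1 vD1 ev; have e2 := cross_mem DM2 vD2 ev.
  have yD1 : y \notin D1 by move: e1; rewrite (in_cross _ ev) vD1.
  have yD2 : y \notin D2 by move: e2; rewrite (in_cross _ ev) vD2.
  rewrite (negbTE yD1) yD2 /=; apply/andP; split; last first.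
    apply/forall_inP=> e'; rewrite in_inc => /andP[e'D e'y].
    have [->|ne] := eqVneq e' e; first by rewrite oy.
    exact: (opp_shared yD1 e1 ey e'D e'y ne).
  have /eqP/cards1P[m2 Mm2] := DPset_matched DM2 yD2; have [mM2 my] := inc1_mem Mm2.
  have /eqP/cards1P[m1 Mm1] := DPset_matched DM1 yD1.
  rewrite Mm1 sub1set.
  (* If the [M2]-edge at [y] crossed [D1], [opp_shared] would put its far end in [D2], where no edge
     of [M2] ends. *)
  case/orP: (minimal_edgeP minG m2 DM1) => [mM1|mD].
    suff -> : m1 = m2 by [].
    by apply/esym/set1P; rewrite -Mm1 in_inc mM1.
  have ne : m2 != e by apply: contraTneq e2 => <-; apply: matching_not_cross DM2 mM2.
  have := opp_shared yD1 e1 ey mD my ne.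
  by rewrite (negbTE (DPset_outside DM2 mM2 (incident_opp my))).
case/orP: (minimal_edgeP minG e DM1) => [eM1|eD1]; last first.
  have -> : y \in D1 by move: eD1; rewrite (in_cross _ ev) (negbTE vD1).
  by apply: Cv; rewrite in_inc eD1.
have eM2 : e \in M2 by apply: (subsetP Mv); rewrite in_inc eM1.
have yD1 := DPset_outside DM1 eM1 ey; have yD2 := DPset_outside DM2 eM2 ey.
have /eqP/cards1P[m Mm] := DPset_matched DM1 yD1.
have em x : x \in M1 -> incident x y -> x = e.
  move=> xM xy; have xm : x = m by apply/set1P; rewrite -Mm in_inc xM.
  by rewrite xm; apply/esym/set1P; rewrite -Mm in_inc eM1.
rewrite (negbTE yD1) yD2 /=; apply/andP; split.
  by apply/subsetP=> x; rewrite in_inc => /andP[xM xy]; rewrite (em x).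
(* The edge [c] leads from [y] into [D2]. It also crosses [D1], since the only [M1]-edge at [y] is
   [e], which lies in [M2]; so [opp_shared] handles every other edge crossing [D1] at [y]. *)
have /set0Pn[c] := DPset_cross DM2 y; rewrite in_inc => /andP[cD2 cy].
have cD1 : c \in cross D1.
  case/orP: (minimal_edgeP minG c DM1) => // /em/(_ cy) ce.
  by move: cD2; rewrite ce (negbTE (matching_not_cross DM2 eM2)).
apply/forall_inP=> x; rewrite in_inc => /andP[xD xy].
have [->|ne] := eqVneq x c; last exact: (opp_shared yD1 cD1 cy xD xy ne).
by move: cD2; rewrite (in_cross _ cy) (negbTE yD2).
Qed.

Lemma meeting_eq : connected G -> D1 :&: D2 != set0 -> D1 = D2.
Proof.
move=> conG /set0Pn[x]; rewrite in_setI => /andP[xD1 xD2].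
suff ag v : agree v.
  by apply/setP=> v; have := ag v; rewrite /agree; case: ifP => [_ -> // | _ /and3P[/negbTE->]].
have : agree x by rewrite /agree xD1.
have /connectP[p] := conG x v; elim: p x {xD1 xD2} => [x _ -> //|y p IHp x /=].
by case/andP=> /adjP[e ex <-] yp lp /(agree_opp ex); apply: IHp.
Qed.

(** If the crossing edge [e] at [v] were not the only one there, its end in [D1] would be pendant
    and hence also in [D2]. So [v] has one crossing edge and one matching edge. *)
Lemma disjoint_card_outside v : [disjoint D1 & D2] -> v \notin D1 -> #|inc setT v| = 2.
Proof.
move=> dis vD1; have /set0Pn[e] := DPset_cross DM1 v; rewrite in_inc => /andP[eD ev].
have /eqP/cards1P[m Mm] := DPset_matched DM1 vD1; have [mM mv] := inc1_mem Mm.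
have od : opp e v \in D1 by move: eD; rewrite (in_cross _ ev) (negbTE vD1).
case: (minimal_star minG DM1 eD ev) => [ce|]; last first.
  by rewrite (inc_cross DM1 od) => /(pendant_mem DM2); rewrite (disjointFr dis od).
have me : m != e by apply: contraNneq (matching_not_cross DM1 mM) => ->.
suff -> : inc setT v = [set m; e] by rewrite cards2 me.
apply/setP=> x; rewrite in_inc in_setT in_set2 /=; apply/idP/orP=> [xv|[]/eqP-> //].
case/orP: (minimal_edgeP minG x DM1) => [xM|xD].
  by left; rewrite -in_set1 -Mm in_inc xM.
by right; rewrite -in_set1 -ce in_inc xD.
Qed.

End Compare.

Lemma disjoint_card D1 D2 M1 M2 v : DPset D1 M1 -> DPset D2 M2 ->
  [disjoint D1 & D2] -> #|inc setT v| = 2.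
Proof.
move=> DM1 DM2 dis; have [vD1|vD1] := boolP (v \in D1); last first.
  exact: (disjoint_card_outside DM1 DM2 dis vD1).
rewrite disjoint_sym in dis; apply: (disjoint_card_outside DM2 DM1 dis).
by rewrite (disjointFl dis vD1).
Qed.

End TwoPairs.

(** * Counting *)

Section Counting.
Variables (G : mgraph) (D : {set vert G}) (M : {set edge G}).
Hypothesis DM : DPset D M.

Lemma sum_inc (W : {set vert G}) (F : {set edge G}) :
  \sum_(v in W) #|inc F v| = \sum_(e in F) #|[set v in W | incident e v]|.
Proof.
under eq_bigr do rewrite -sum1dep_card big_mkcondr.
under [RHS]eq_bigr do rewrite -sum1dep_card big_mkcondr.
exact: exchange_big.
Qed.

Lemma card_outside : #|~: D| = #|M|.*2.
Proof.
rewrite -sum1_card (eq_bigr (fun v => #|inc M v|)) => [|v]; last first.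
  by rewrite inE => /(DPset_matched DM)->.
rewrite sum_inc (eq_bigr (fun=> 2)) ?sum_nat_const ?muln2 // => e eM.
have -> : [set v in ~: D | incident e v] = [set (endpts e).1; (endpts e).2].
  apply/setP=> v; rewrite !inE /incident !(eq_sym v).
  case: (boolP (_ || _)) => ev; rewrite ?andbF // andbT.
  exact: (DPset_outside DM eM ev).
by rewrite cards2 (DPset_loopless DM eM).
Qed.

Lemma card_cross_inside : #|cross D| = \sum_(v in D) #|inc (cross D) v|.
Proof.
rewrite sum_inc -sum1_card; apply: eq_bigr => e eD; apply/esym/eqP/cards1P.
move: eD; rewrite (in_cross _ (incident1 e)) => eD.
have := incident1 e; set v := (endpts e).1 in eD * => ev.
exists (if v \in D then v else opp e v); apply/setP=> u.
rewrite !inE (incidentE _ ev); move: eD; case: ifP => [vD /= oD | vD /= oD].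
  by apply/andP/eqP=> [[uD /orP[]/eqP//]|->]; [move=> uo; rewrite uo (negbTE oD) in uD | rewrite vD eqxx].
by apply/andP/eqP=> [[uD /orP[]/eqP//]|->]; [move=> uo; rewrite uo vD in uD | rewrite oD eqxx orbT].
Qed.

Lemma cross_setC : cross (~: D) = cross D.
Proof. by apply/setP=> e; rewrite !inE addbN addNb negbK. Qed.

Lemma leq_card_cross : #|D| <= #|cross D|.
Proof.
rewrite card_cross_inside -sum1_card leq_sum // => v _.
by rewrite card_gt0; apply: DPset_cross DM v.
Qed.

Lemma disjoint_matching_cross : [disjoint M & cross D].
Proof. by apply/pred0P=> e /=; apply/negP=> /andP[/(matching_not_cross DM)/negP]. Qed.

End Counting.

(** One of the at most two edges at a vertex outside [D] is matched, so exactly one crosses; the cut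
    thus has as many edges as [~: D] has vertices. *)
Lemma card_cross_outside (G : mgraph) (D : {set vert G}) (M : {set edge G}) :
  DPset D M -> (forall v : vert G, #|inc setT v| <= 2) -> #|cross D| = #|M|.*2.
Proof.
move=> DM le2; rewrite -(card_outside DM) -cross_setC card_cross_inside cross_setC -sum1_card.
apply: eq_bigr => v; rewrite inE => vD; apply/eqP; rewrite eqn_leq card_gt0 (DPset_cross DM) andbT.
rewrite -ltnS; apply: leq_trans (le2 v); have /eqP/cards1P[m Mm] := DPset_matched DM vD.
have [mM mv] := inc1_mem Mm; apply/proper_card/properP; split.
  by apply/subsetP=> e; rewrite !in_inc in_setT => /andP[].
by exists m; rewrite in_inc ?in_setT // (negbTE (matching_not_cross DM mM)).
Qed.

Lemma matched_cross_disjoint (G : mgraph) (D : {set vert G}) (M : {set edge G}) :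
  DPset D M -> #|M| + #|cross D| = #|M :|: cross D|.
Proof. by move=> DM; rewrite cardsU disjoint_setI0 ?cards0 ?subn0 ?disjoint_matching_cross. Qed.

(** * Cycles *)

Lemma cycle_inc_le2 n (v : vert (cycle_graph n)) : #|inc setT v| <= 2.
Proof.
have le2 : #|[set v; ord_pred v]| <= 2 by rewrite cards2; case: (_ != _).
apply: leq_trans le2; apply/subset_leq_card/subsetP=> i; rewrite in_inc /incident /= !inE /=.
by case/orP=> /eqP <-; rewrite ?eqxx // ordSK eqxx orbT.
Qed.

(** In a proper spanning subgraph with [m] matching edges the cut has [2m] edges, so [3m < n]. As
    [D] has at most [2m] vertices and its complement has [2m], also [n <= 4m]; no such [m] exists
    for 3, 6 or 9. *)
Lemma cycle_minimal n : n \in [:: 3; 6; 9] -> DPDP (cycle_graph n) -> minimal_DPDP (cycle_graph n).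
Proof.
move=> n369 dp; split=> // F pF [D [_ /DP_pairP[_ [M DM]]]].
have le2 (v : vert (restrict F)) : #|inc setT v| <= 2.
  apply: leq_trans (@cycle_inc_le2 n v).
  rewrite -(card_imset _ val_inj); apply/subset_leq_card/subsetP=> _ /imsetP[e ev ->].
  by move: ev; rewrite !inE.
have cF : #|F| < n by have := proper_card pF; rewrite cardsT card_ord.
have : #|M| + #|cross D| <= #|F|.
  rewrite (matched_cross_disjoint DM); apply: leq_trans (max_card _) _.
  by rewrite card_sig; apply: subset_leq_card; apply/subsetP.
have := leq_card_cross DM; have := card_outside DM; have := cardsC D.
rewrite (card_cross_outside DM le2) card_ord.
by move: n369; rewrite !inE; lia.
Qed.

Lemma val_ordS n (i : 'I_n) : ordS i = (if i.+1 == n then 0 else i.+1) :> nat.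
Proof.
rewrite /=; case: eqP => [->|ne]; first exact: modnn.
by rewrite modn_small //; have := ltn_ord i; lia.
Qed.

(* The vertices 0, 3, 4, 7, 8, 11, 14, 17, ... and the edges leaving 1, 5, 9,
   12, 15, ...: the blocks D P P D, D P P D, D P P D, then P P D repeated. *)
Definition long_in (i : nat) : bool :=
  if i < 12 then i \in [:: 0; 3; 4; 7; 8; 11] else i %% 3 == 2.
Definition long_matched (i : nat) : bool :=
  if i < 12 then i \in [:: 1; 5; 9] else i %% 3 == 0.

(** The conditions of [DPset] along a path whose edge [i] joins [i] to [i.+1]. The first twelve
    values of [i] are computed; later ones depend only on the residue mod 3. *)
Lemma long_step i :
  [/\ long_matched i -> ~~ long_in i && ~~ long_in i.+1,
      long_in i.+1 || (long_matched i (+) long_matched i.+1)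
    & (long_in i.+1 (+) long_in i.+2) || (long_in i.+1 (+) long_in i)].
Proof.
do 12 (case: i => [//|i]); have modE k : (k + i) %% 3 = (k + i %% 3) %% 3 by rewrite modnDmr.
rewrite /long_in /long_matched /= (modE 12) (modE 13) (modE 14).
by have := ltn_pmod i (isT : 0 < 3); case: (i %% 3) => [|[|[|r]]].
Qed.

(** The seam of the cycle: the edge from the last vertex back to 0 is unmatched, and the last vertex
    gets its crossing edge from its predecessor. *)
Lemma long_last m i : 3 < m -> i.+1 = 3 * m ->
  [/\ long_in i, ~~ long_matched i & ~~ long_in i.-1].
Proof.
case: m => [|[|[|[|m]]]] // _ E; have -> : i = 3 * m + 11 by lia.
case: m {E} => [//|m]; have -> : 3 * m.+1 + 11 = m * 3 + 14 by lia.
have ge12 : (m * 3 + 14 < 12) = false by lia.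
have ge13 : (m * 3 + 13 < 12) = false by lia.
have -> : (m * 3 + 14).-1 = m * 3 + 13 by lia.
by rewrite /long_in /long_matched ge12 ge13 !modnMDl.
Qed.

Lemma long_cycle_DPset m : 3 < m ->
  DPset [set i : vert (cycle_graph (3 * m)) | long_in i]
        [set i : edge (cycle_graph (3 * m)) | long_matched i].
Proof.
move=> m4; have matchedS (i : 'I_(3 * m)) : long_matched i -> ordS i = i.+1 :> nat.
  by move=> iM; rewrite val_ordS; case: eqP => // /(long_last m4)[_]; rewrite iM.
have iv (i v : 'I_(3 * m)) :
    @incident (cycle_graph (3 * m)) i v = (i == v :> nat) || (ordS i == v :> nat) by [].
split.
- move=> i; rewrite inE => /matchedS iS.
  by apply/eqP=> /(congr1 (@nat_of_ord _)); rewrite /= in iS *; rewrite iS; lia.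
- move=> i v; rewrite !inE iv => iM; have [/(_ iM)/andP[iD sD] _ _] := long_step i.
  by case/orP=> /eqP <-; rewrite ?matchedS.
- move=> v; rewrite inE => vD; have [w vw] : exists w, v = w.+1 :> nat.
    by case: (nat_of_ord v) vD => // w _; exists w.
  have wn : w < 3 * m by rewrite -ltnS -vw ltnW // ltnS ltn_ord.
  have [_ + _] := long_step w; rewrite -vw (negbTE vD) /= => wv.
  apply/eqP/cards1P; exists (if long_matched v then v else Ordinal wn).
  apply/setP=> i; rewrite (@in_inc (cycle_graph (3 * m))) in_set1 iv inE.
  have eqi j : (i == j) = (i == j :> nat) by [].
  apply/andP/idP => [[iM] | ]; last first.
    case: ifP => [vM /eqP->|vM /eqP->]; first by rewrite vM eqxx.
    have wM : long_matched w by rewrite vM addbF in wv.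
    by rewrite (@matchedS (Ordinal wn) wM) /= vw eqxx orbT.
  rewrite (matchedS i iM) => /orP[]/eqP iE.
    by rewrite -iE iM eqi iE eqxx.
  have iw : i = w :> nat by move: iE; rewrite vw => -[].
  by rewrite -iw iM in wv; rewrite (negbTE wv) eqi /= iw eqxx.
move=> v; apply/set0Pn.
have [ne|eq] := boolP (long_in v (+) long_in (ordS v)).
  by exists v; rewrite in_inc incident1 !inE ne.
(* The edge leaving 0 crosses, so here [v] is not 0 and the edge entering [v] can be used. *)
have v0 : v != 0 :> nat.
  apply: contraNneq eq => v0; rewrite val_ordS v0.
  by have -> : (1 == 3 * m) = false by lia.
have [w vw] : exists w, v = w.+1 :> nat by case: (nat_of_ord v) v0 => // w _; exists w.
have wn : w < 3 * m by rewrite -ltnS -vw ltnW // ltnS ltn_ord.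
have sw : ordS (Ordinal wn) = v.
  by apply: ord_inj; rewrite val_ordS /= -vw; case: eqP (ltn_ord v) => // ->; rewrite ltnn.
exists (Ordinal wn); rewrite in_inc iv sw eqxx orbT andbT inE /= sw !inE addbC.
have [_ _] := long_step w; rewrite -vw => /orP[E|//].
move: eq; rewrite val_ordS; case: eqP => [/(long_last m4)[vD _]|_]; last by rewrite E.
by rewrite vD vw => /negbTE->.
Qed.

(** Every edge is matched or crosses, which gives [n = 3 * #|M|]; from four matching edges on, the
    pair of [long_cycle_DPset] contradicts minimality. *)
Lemma minimal_cycle n : 0 < n -> minimal_DPDP (cycle_graph n) -> n \in [:: 3; 6; 9].
Proof.
move=> n0 minC; have [[D [_ /DP_pairP[_ [M DM]]]] _] := minC.
have nE : n = 3 * #|M|.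
  have := matched_cross_disjoint DM; rewrite (card_cross_outside DM (@cycle_inc_le2 n)).
  have -> : M :|: cross D = setT.
    by apply/setP=> e; rewrite in_setU in_setT; apply: minimal_edgeP DM.
  by rewrite cardsT card_ord; lia.
move: #|M| nE => m nE; subst n.
have [m3|m4] := leqP m 3; first by rewrite !inE; lia.
(* Edge 3 joins the vertices 3 and 4, both in the long set, so it is neither matched nor
   crossing. *)
have lt3 : 3 < 3 * m by lia.
have := minimal_edgeP minC (Ordinal lt3) (long_cycle_DPset m4).
rewrite !inE val_ordS /=; case: (4 =P 3 * m) => /=; lia.
Qed.

(** * Connected 2-regular graphs *)

(** A pair [(e, b)] is a dart, an edge with a chosen end; a loop gives two darts at its vertex. *)
Definition tail (G : mgraph) (x : edge G * bool) : vert G := endside x.1 x.2.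

Section TwoRegular.
Variable G : mgraph.
Notation dart := (edge G * bool)%type.
Implicit Types (x y z : dart) (v : vert G).

Definition flip x : dart := (x.1, ~~ x.2).
(** The default [x] is never taken when every vertex has exactly two darts. *)
Definition twin x : dart := odflt x [pick y | (tail y == tail x) && (y != x)].
(** One step of a walk: cross the edge, then leave the vertex reached by its other dart. *)
Definition next x : dart := twin (flip x).

Hypothesis darts2 : forall v, #|[set x : dart | tail x == v]| = 2.

Lemma flipK : involutive flip.
Proof. by case=> e b; rewrite /flip negbK. Qed.

Lemma twinP x : tail (twin x) = tail x /\ twin x != x.
Proof.
rewrite /twin; case: pickP => [y /andP[/eqP-> ->] // | none].
have: #|[set y : dart | tail y == tail x]| <= #|[set x]|.
  apply/subset_leq_card/subsetP=> y; rewrite !inE => yx.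
  by have := none y; rewrite yx => /negbFE.
by rewrite darts2 cards1.
Qed.

Lemma tail_eq x y : tail y = tail x -> y = x \/ y = twin x.
Proof.
move=> yx; have [-> | yx1] := eqVneq y x; first by left.
have [tx nx] := twinP x; right; apply/eqP/negPn/negP=> yt.
have: #|[set y; x; twin x]| <= #|[set z : dart | tail z == tail x]|.
  by apply/subset_leq_card/subsetP=> z; rewrite !inE => /orP[/orP[]|] /eqP->; rewrite ?yx ?tx.
by rewrite darts2 setUC cardsU1 cards2 !inE negb_or nx (eq_sym _ y) yt yx1.
Qed.

Lemma twinK : involutive twin.
Proof.
move=> x; have [tx nx] := twinP x; have [ttx nnx] := twinP (twin x).
have [//|E] : twin (twin x) = x \/ twin (twin x) = twin x by apply: tail_eq; rewrite ttx tx.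
by rewrite E eqxx in nnx.
Qed.

Lemma next_inj : injective next.
Proof. exact: inj_comp (inv_inj twinK) (inv_inj flipK). Qed.

Lemma tail_next x : tail (next x) = tail (flip x).
Proof. by have [] := twinP (flip x). Qed.

(* [next] conjugated by [flip] is the inverse of [next], so a walk meeting its
   own reversal would contain a dart fixed by [flip] or by [twin]. *)
Lemma iter_next_flip k x : iter k next x != flip x.
Proof.
have [n] := ubnP k; elim: n k x => // n IHn [|[|k]] x ltkn.
- by case: x => e b; rewrite /flip xpair_eqE eqxx; case: b.
- by have [] := twinP (flip x).
(* One step is peeled off at each end, since [next (flip (next x))] is [flip x]. *)
apply: contra (IHn k (next x) _) => [/eqP E|]; last by lia.
apply/eqP/next_inj; rewrite -iterS -iterSr E /next.
by rewrite flipK twinK.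
Qed.

Lemma iter_next_twin k x : iter k next x != twin x.
Proof.
case: k => [|k] /=; first by rewrite eq_sym; have [] := twinP x.
rewrite -[in twin x](flipK x) -[twin _]/(next _) (inj_eq next_inj).
exact: iter_next_flip.
Qed.

(** Distinct darts with the same tail are twins, and [iter_next_twin] keeps twins off a common
    orbit. *)
Lemma tail_iter_inj x i j : i < order next x -> j < order next x ->
  tail (iter i next x) = tail (iter j next x) -> i = j.
Proof.
wlog leij: i j / i <= j => [H|] io jo E.
  by case: (leqP i j) => [/H|/ltnW/H HH]; [apply | apply/esym/HH].
have [E'|] := tail_eq (esym E).
  by rewrite -(findex_iter io) -(findex_iter jo) E'.
by rewrite -(subnK leij) iterD => /eqP; rewrite (negbTE (iter_next_twin _ _)).
Qed.

Lemma edge_iter_inj x i j : i < order next x -> j < order next x ->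
  (iter i next x).1 = (iter j next x).1 -> i = j.
Proof.
wlog leij: i j / i <= j => [H|] io jo E.
  by case: (leqP i j) => [/H|/ltnW/H HH]; [apply | apply/esym/HH].
have := iter_next_flip (j - i) (iter i next x); rewrite -iterD subnK //.
move=> nf; rewrite -(findex_iter io) -(findex_iter jo); congr (findex _ _ _).
move: E nf; case: (iter i next x) (iter j next x) => e b [e' b'] /= ->.
by rewrite /flip xpair_eqE eqxx /=; case: b; case: b'.
Qed.

Lemma orbit_cover x y : connected G -> fconnect next x y || fconnect next x (flip y).
Proof.
(* A vertex is good when its darts lie on the orbit up to reversal. Goodness spreads along edges: an
   orbit dart [z] has a good tail because [next (flip (twin z))] is [z]. *)
pose good v := [forall (z | tail z == v), fconnect next x z || fconnect next x (flip z)].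
have nextc z : fconnect next x (next z) = fconnect next x z.
  by rewrite -(same_fconnect1_r next_inj).
have good_of z : fconnect next x z -> good (tail z).
  move=> xz; apply/forall_inP=> w /eqP/tail_eq[-> | ->]; first by rewrite xz.
  by rewrite orbC -nextc /next flipK twinK xz.
have good_flip z : good (tail z) -> good (tail (flip z)).
  move=> /forall_inP/(_ z (eqxx _))/orP[xz|xz]; last exact: good_of.
  by rewrite -tail_next; apply: good_of; rewrite nextc.
move=> conG; suff /forall_inP/(_ y (eqxx _)) : good (tail y) by [].
have := good_of x (connect0 _ _); have /connectP[p] := conG (tail x) (tail y).
elim: p (tail x) => [v _ -> //|w p IHp v /= /andP[/adjP[e ev <-] wp] lp gv].
apply: IHp wp lp _; case: (eqVneq (endpts e).1 v) => [ve|ne].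
  have -> : opp e v = tail (flip (e, true)) by rewrite /opp ve eqxx.
  by apply: good_flip; rewrite /tail /= ve.
move: ev; rewrite /incident (negbTE ne) => /eqP ve.
have -> : opp e v = tail (flip (e, false)) by rewrite /opp (negbTE ne).
by apply: good_flip; rewrite /tail /= ve.
Qed.

(** The orbit of one dart under [next] is the whole cycle: its tails list the vertices and its edges
    list the edges, each once. *)
Lemma two_regular_cycle : connected G -> vert G -> exists2 n, 0 < n & iso G (cycle_graph n).
Proof.
move=> conG v0; have [x _] : exists x : dart, x \in [set x : dart | tail x == v0].
  by apply/set0Pn; rewrite -card_gt0 darts2.
pose n := order next x; exists n; first exact: order_gt0.
apply: iso_sym.
pose d (i : 'I_n) := iter i next x.
have onto (y : dart) : exists i : 'I_n, tail (d i) = tail y /\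
     exists j : 'I_n, (d j).1 = y.1.
  have nth z : fconnect next x z -> exists i : 'I_n, d i = z.
    by move=> xz; exists (Ordinal (findex_max xz)); apply: iter_findex.
  case/orP: (orbit_cover x y conG) => [xy | xy].
    by have [i di] := nth y xy; exists i; rewrite di; split=> //; exists i; rewrite di.
  (* When the reverse of [y] is on the orbit, the dart following it starts at the tail of [y]. *)
  have [j dj] := nth _ xy.
  have [|i di] := nth (next (flip y)).
    by rewrite -(same_fconnect1_r next_inj).
  by exists i; rewrite di tail_next flipK; split=> //; exists j; rewrite dj.
exists (fun i : vert (cycle_graph n) => tail (d i)), (fun i : edge (cycle_graph n) => (d i).1).
split.
- apply: inj_surj_bij => [i j /(tail_iter_inj (ltn_ord i) (ltn_ord j)) /ord_inj // | v].
  have [y] : exists y : dart, y \in [set y : dart | tail y == v].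
    by apply/set0Pn; rewrite -card_gt0 darts2.
  by rewrite inE => /eqP <-; have [i [di _]] := onto y; exists i.
- apply: inj_surj_bij => [i j /(edge_iter_inj (ltn_ord i) (ltn_ord j)) /ord_inj // | e].
  by have [_ [_ [j dj]]] := onto (e, true); exists j.
move=> i /=.
have -> : tail (d (ordS i)) = tail (flip (d i)).
  rewrite -tail_next /d val_ordS -iterS; case: eqP => [->|//].
  by rewrite iter_order //; apply: next_inj.
rewrite /tail /flip; case: (d i) => e b /=; case: b => /=; [left|right]; exact: surjective_pairing.
Qed.

End TwoRegular.

Lemma loopless_darts (G : mgraph) (v : vert G) : (forall e : edge G, (endpts e).1 != (endpts e).2) ->
  #|[set x : edge G * bool | tail x == v]| = #|inc setT v|.
Proof.
move=> noloop; have -> : inc setT v = fst @: [set x : edge G * bool | tail x == v].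
  apply/setP=> e; rewrite in_inc in_setT; apply/idP/imsetP => /=.
    by case/orP=> ev; [exists (e, true) | exists (e, false)]; rewrite // inE.
  by case=> -[e' b]; rewrite inE /tail /incident /= => /eqP <- ->; case: b; rewrite /= eqxx ?orbT.
rewrite card_in_imset // => -[e b] [e' b']; rewrite !inE /tail /= => /eqP <- /eqP + /= ee'.
rewrite -{}ee'; have := noloop e; case: b; case: b' => //= + E; rewrite ?E ?eqxx //.
Qed.

(** * Contracting the stars *)

Lemma deg_darts (G : mgraph) (v : vert G) : deg v = #|[set x : edge G * bool | tail x == v]|.
Proof.
have inj (b : bool) : injective (fun e : edge G => (e, b)) by move=> e e' [].
rewrite /deg -(card_imset _ (inj true)) -(card_imset (mem [set e | (endpts e).2 == v]) (inj false)).
rewrite -cardsUI (_ : _ :&: _ = set0) ?cards0 ?addn0; last first.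
  apply/setP=> -[e b]; rewrite !inE; apply/negP=> /andP[/imsetP[e1 _ [_ ->]] /imsetP[e2 _ [_]]].
  by [].
congr #|pred_of_set _|; apply/setP=> -[e b]; rewrite !inE /tail.
apply/orP/idP => [[]/imsetP[e' + [-> ->]]|]; rewrite ?inE //.
by case: b => /= ev; [left|right]; apply/imsetP; exists e; rewrite ?inE.
Qed.

Section Stars.
Variables (G : mgraph) (D : {set vert G}) (M : {set edge G}).
Hypotheses (minG : minimal_DPDP G) (DM : DPset D M).
Implicit Types (e : edge G) (p d v : vert G).

Notation cuts v := (inc (cross D) v).
Definition wide d : bool := 1 < #|cuts d|.

(* The star containing [p] is represented by its centre, taken to be [p] itself
   when the star is a single edge. *)
Definition centre p : vert G :=
  if [pick e in cuts p | wide (opp e p)] is Some e then opp e p else p.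

Lemma wide_other e v : wide v -> e \in cross D -> incident e v -> cuts (opp e v) = [set e].
Proof.
move=> wv ec ev; case: (minimal_star minG DM ec ev) => // ce.
by move: wv; rewrite /wide ce cards1.
Qed.

Lemma narrow_unique e v : ~~ wide v -> e \in cuts v -> cuts v = [set e].
Proof.
rewrite /wide -leqNgt => le1 ev; apply/esym/eqP.
by rewrite eqEcard sub1set ev cards1.
Qed.

(** By [wide_other], a crossing edge with a wide far end is the only one at [p]. If there is none,
    every crossing edge at [p] is alone at its far end, and [p] is itself a centre. *)
Lemma centreP p :
  (exists e, [/\ cuts p = [set e], wide (opp e p) & centre p = opp e p]) \/
  (centre p = p /\ forall e, e \in cuts p -> cuts (opp e p) = [set e]).
Proof.
rewrite /centre; case: pickP => [e /andP[ep we] | none].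
  left; exists e; split=> //; have := ep; rewrite in_inc => /andP[ec ev].
  by rewrite -{1}(oppK ev); apply: wide_other => //; apply: incident_opp.
right; split=> // e ep; have := none e; rewrite ep /= => /negbT nw; apply: narrow_unique nw _.
by move: ep; rewrite !in_inc => /andP[-> /incident_opp].
Qed.

Lemma opp_in e p : p \notin D -> e \in cuts p -> opp e p \in D.
Proof. by move=> pD; rewrite in_inc => /andP[+ ev]; rewrite (in_cross _ ev) (negbTE pD). Qed.

Lemma opp_out e d : d \in D -> e \in cuts d -> opp e d \notin D.
Proof. by move=> dD; rewrite in_inc => /andP[+ ev]; rewrite (in_cross _ ev) dD. Qed.

Lemma centre_outside p : p \notin D -> centre p \notin D -> centre p = p.
Proof.
move=> pD; have [[e [ce _ ->]]|[-> //]] := centreP p.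
by rewrite opp_in // ce set11.
Qed.

(** Every star has a vertex outside [D], so no centre is missed. *)
Definition starV := {v | v \in centre @: ~: D}.
Definition star v (vS : v \in centre @: ~: D) : starV := exist _ v vS.

Lemma starE_outside (e : {e | e \in M}) v : incident (val e) v -> v \in ~: D.
Proof. by move=> ev; rewrite inE (DPset_outside DM (valP e)). Qed.

Definition star_of (e : {e | e \in M}) (v : vert G) (ev : incident (val e) v) : starV :=
  star (imset_f centre (starE_outside ev)).

Definition star_graph : mgraph :=
  @MGraph starV {e | e \in M} (fun a => (star_of (incident1 (val a)), star_of (incident2 (val a)))).

(** Where a dart of the contraction sits in [G]. Since [M] matches the vertices outside [D], darts
    correspond bijectively to those vertices. *)
Definition pt (x : edge star_graph * bool) : vert G := endside (val x.1) x.2.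

Lemma incident_pt x : incident (val x.1) (pt x).
Proof. by case: x => e [] /=; [apply: incident1 | apply: incident2]. Qed.

Lemma val_tail (x : edge star_graph * bool) : val (tail x) = centre (pt x).
Proof. by case: x => e []. Qed.

Lemma pt_outside x : pt x \notin D.
Proof. exact: (DPset_outside DM (valP x.1) (incident_pt x)). Qed.

Lemma pt_inj : injective pt.
Proof.
move=> [e b] [e' b'] E; have /eqP/cards1P[m Mm] := DPset_matched DM (pt_outside (e, b)).
have em : val e = m by apply/set1P; rewrite -Mm in_inc (valP e) (incident_pt (e, b)).
have em' : val e' = m by apply/set1P; rewrite -Mm in_inc (valP e') E (incident_pt (e', b')).
have ee : e' = e by apply: val_inj; rewrite em em'.
subst e'; move: E (DPset_loopless DM (valP e)) {m Mm em em'}; rewrite /pt /endside /=.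
by case: b; case: b' => //= ->; rewrite eqxx.
Qed.

Lemma pt_surj p : p \notin D -> exists x, pt x = p.
Proof.
move=> pD; have /eqP/cards1P[m Mm] := DPset_matched DM pD; have [mM] := inc1_mem Mm.
by case/orP=> /eqP mp; [exists (exist _ m mM, true) | exists (exist _ m mM, false)].
Qed.

Lemma star_out (v : vert star_graph) : val v \notin D -> centre (val v) = val v.
Proof.
case: v => v /= /imsetP[p]; rewrite inE => pD -> cD.
by rewrite !(centre_outside pD cD).
Qed.

Lemma star_in (v : vert star_graph) : val v \in D -> wide (val v).
Proof.
case: v => v /= /imsetP[p]; rewrite inE => pD ->.
by have [[e [_ we ->]] //|[-> _]] := centreP p; rewrite (negbTE pD).
Qed.

Lemma centre_wide e d : d \in D -> wide d -> e \in cuts d -> centre (opp e d) = d.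
Proof.
move=> dD wd ed; have := ed; rewrite in_inc => /andP[ec ev].
have [[e' [ce' _ ->]]|[_ /(_ e)]] := centreP (opp e d).
  have : e \in [set e'] by rewrite -ce' in_inc ec incident_opp.
  by move/set1P <-; rewrite oppK.
rewrite in_inc ec incident_opp // oppK // => /(_ isT) cd.
by move: wd; rewrite /wide cd cards1.
Qed.

(** The degree counts the vertices outside [D] in the star: a centre outside [D] is the only one,
    while a centre in [D] is wide and has at least two around it. *)
Lemma star_leaf (v : vert star_graph) : leaf v = (val v \notin D).
Proof.
rewrite /leaf deg_darts; have [vD|vD] := boolP (val v \in D); last first.
  have [x xv] := pt_surj vD; apply/cards1P; exists x; apply/setP=> y; rewrite !inE.
  rewrite -(inj_eq val_inj) val_tail; apply/eqP/eqP => [yv|->]; last by rewrite xv star_out.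
  by apply: pt_inj; rewrite xv -yv centre_outside ?yv ?pt_outside.
have wv := star_in vD; have := wv; rewrite /wide => /card_gt1P[e1 [e2 [e1v e2v ne]]].
apply/negbTE/negP=> /cards1P[x Ex].
have dart e : e \in cuts (val v) -> pt x = opp e (val v).
  move=> ev; have [y yv] := pt_surj (opp_out vD ev).
  suff -> : x = y by [].
  by apply/esym/set1P; rewrite -Ex inE -(inj_eq val_inj) val_tail yv centre_wide.
have d1 := dart _ e1v; have d2 := dart _ e2v.
move: e1v e2v; rewrite !in_inc => /andP[c1 i1] /andP[c2 i2].
have := wide_other wv c1 i1; rewrite -d1 d2 (wide_other wv c2 i2) => /set1_inj E.
by rewrite E eqxx in ne.
Qed.

(** At a leaf of the contraction this is the number of vertices of [D] in the star. *)
Definition star_alpha (v : vert star_graph) : nat := #|cuts (val v)|.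

Lemma star_alpha_gt0 (v : vert star_graph) : 0 < star_alpha v.
Proof. by rewrite card_gt0; apply: DPset_cross DM (val v). Qed.

Lemma star_no_isolated : no_isolated star_graph.
Proof.
case=> v vS; rewrite deg_darts cards_eq0; apply/set0Pn.
have /imsetP[p] := vS; rewrite inE => /pt_surj[x xp] vp; exists x.
by rewrite inE -(inj_eq val_inj) val_tail xp /= vp.
Qed.

(** The default [e0] is never taken, as every vertex has a crossing edge. *)
Definition cut_of p (e0 : edge G) : edge G := odflt e0 [pick e in cuts p].

Lemma cut_ofP p e0 : cut_of p e0 \in cuts p.
Proof.
rewrite /cut_of; case: pickP => //= none; have /set0Pn[e] := DPset_cross DM p.
by rewrite none.
Qed.

(** * The subdivision of the contraction is the original graph *)

Definition copy_edge (u : LCvert star_alpha) : edge G := enum_val (tagged u).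

(** Non-leaves go to the wide vertices of [D], leaf copies to the other vertices of [D], and new
    vertices to the complement of [D]. *)
Definition S2_vert_inv (u : vert (S2 star_alpha)) : vert G :=
  match u with
  | inl (inl v) => val (val v)
  | inl (inr u) => opp (copy_edge u) (val (val (tag u)))
  | inr x => pt x
  end.

(** Middle edges go to [M], an edge at a non-leaf to the unique crossing edge at its new end, and an
    edge at a copy to the star edge numbered by the copy. *)
Definition S2_edge_inv (a : edge (S2 star_alpha)) : edge G :=
  match a with
  | inl e => val e
  | inr (inl y) => cut_of (pt (val y)) (val (val y).1)
  | inr (inr q) => copy_edge (val q).1
  end.

Lemma copy_edgeP (u : LCvert star_alpha) : copy_edge u \in cuts (val (val (tag u))).
Proof. exact: enum_valP. Qed.

Lemma copy_out (u : LCvert star_alpha) : val (val (tag u)) \notin D.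
Proof. by rewrite -star_leaf (valP (tag u)). Qed.

Lemma copy_narrow (u : LCvert star_alpha) :
  cuts (opp (copy_edge u) (val (val (tag u)))) = [set copy_edge u].
Proof.
have uD := copy_out u; have cu := star_out uD; have uc := copy_edgeP u.
have [[e [ce _ E]]|[_ -> //]] := centreP (val (val (tag u))).
have eu : e \in cuts (val (val (tag u))) by rewrite ce set11.
by have := opp_in uD eu; rewrite -E cu (negbTE uD).
Qed.

Lemma copy_edge_inj : injective copy_edge.
Proof.
move=> u u' E; have := copy_narrow u'; have := copy_narrow u; rewrite -E.
have := copy_edgeP u; have := copy_edgeP u'; rewrite -E !in_inc.
move=> /andP[c i'] /andP[_ i].
have vE : val (val (tag u')) = val (val (tag u)).
  move: i'; rewrite (incidentE _ i) => /orP[/eqP-> //|/eqP uo].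
  have := copy_out u'; rewrite uo (opp_in (copy_out u)) // in_inc c //.
move=> _ _; case: u u' E vE {c i i'} => v i [v' i'] /= E vE.
have vv : v' = v by do 2!apply: val_inj.
by subst v'; congr (existT _ _ _); apply: (@enum_val_inj _ (mem (cuts (val (val v))))).
Qed.

(* Crossing edges at wide vertices of [D] come from incidences at non-leaves, the
   others from copies of leaves. *)
Lemma nonleaf_cut (y : E2 star_graph) (c := cut_of (pt (val y)) (val (val y).1)) :
  [/\ c \in cuts (pt (val y)), wide (opp c (pt (val y))), centre (pt (val y)) = opp c (pt (val y))
    & opp c (pt (val y)) \in D].
Proof.
have := valP y; rewrite star_leaf -/(tail (val y)) val_tail negbK.
have cP : c \in cuts (pt (val y)) := cut_ofP _ _.
have [[e [ce we ->]]|[-> _]] := centreP (pt (val y)); last by rewrite (negbTE (pt_outside _)).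
by move: cP (cP); rewrite {1}ce => /set1P-> ? ?.
Qed.

Lemma S2_vert_inv_inj : injective S2_vert_inv.
Proof.
have nl (v : NLvert star_graph) : val (val v) \in D by have := valP v; rewrite star_leaf negbK.
have lc u : opp (copy_edge u) (val (val (tag u))) \in D := opp_in (copy_out u) (copy_edgeP u).
have nlw (v : NLvert star_graph) : wide (val (val v)) := star_in (nl v).
have lcw u : ~~ wide (opp (copy_edge u) (val (val (tag u)))) by rewrite /wide copy_narrow cards1.
move=> [[v|u]|x] [[v'|u']|x'] /= E.
- by do 2!congr inl; do 2!apply: val_inj.
- by have := lcw u'; rewrite -E nlw.
- by have := pt_outside x'; rewrite -E nl.
- by have := lcw u; rewrite E nlw.
- do 2!congr (_ _); apply: copy_edge_inj; apply: set1_inj.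
  by rewrite -(copy_narrow u) E copy_narrow.
- by have := pt_outside x'; rewrite -E lc.
- by have := pt_outside x; rewrite E nl.
- by have := pt_outside x; rewrite E lc.
- by congr inr; apply: pt_inj.
Qed.

Lemma copy_edge_surj (v : vert star_graph) e : val v \notin D -> e \in cuts (val v) ->
  exists u : LCvert star_alpha, val (tag u) = v /\ copy_edge u = e.
Proof.
rewrite -star_leaf => lv ev.
exists (existT _ (exist _ v lv) (enum_rank_in ev e) : LCvert star_alpha).
by rewrite /copy_edge /= enum_rankK_in.
Qed.

Lemma narrow_copy e d : d \in D -> e \in cuts d -> ~~ wide d ->
  exists u : LCvert star_alpha, val (val (tag u)) = opp e d /\ copy_edge u = e.
Proof.
move=> dD ed nd; have pD := opp_out dD ed.
have := ed; rewrite in_inc => /andP[ec ev].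
have cp : centre (opp e d) = opp e d.
  have [[e' [ce' we' _]]|[-> //]] := centreP (opp e d).
  have : e \in [set e'] by rewrite -ce' in_inc ec incident_opp.
  by move/set1P=> ee; move: we'; rewrite -ee oppK // (negbTE nd).
have pS : opp e d \in centre @: ~: D by rewrite -{1}cp imset_f // inE.
have [|u [uv ue]] := @copy_edge_surj (star pS) e pD; first by rewrite in_inc ec incident_opp.
by exists u; rewrite uv.
Qed.

Lemma wide_star d : d \in D -> wide d -> exists v : NLvert star_graph, val (val v) = d.
Proof.
move=> dD wd; have /set0Pn[e ed] := DPset_cross DM d.
have dS : d \in centre @: ~: D.
  by rewrite -(centre_wide dD wd ed) imset_f // inE opp_out.
have lv : ~~ @leaf star_graph (star dS) by rewrite star_leaf dD.
by exists (exist _ (star dS) lv : NLvert star_graph).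
Qed.

Lemma S2_vert_inv_surj v : exists u, S2_vert_inv u = v.
Proof.
have [vD|/pt_surj[x <-]] := boolP (v \in D); last by exists (inr x).
have [wv|nv] := boolP (wide v); first by have [u <-] := wide_star vD wv; exists (inl (inl u)).
have /set0Pn[e ev] := DPset_cross DM v; have [u [uv ue]] := narrow_copy vD ev nv.
exists (inl (inr u)); rewrite /= uv ue oppK //.
by move: ev; rewrite in_inc => /andP[].
Qed.

Lemma S2_edge_inv_inj : injective S2_edge_inv.
Proof.
have Mc (a : {e | e \in M}) c : c \in cross D -> val a <> c.
  by move=> cD E; have := matching_not_cross DM (valP a); rewrite E cD.
have yc (y : E2 star_graph) : cut_of (pt (val y)) (val (val y).1) \in cross D.
  by have [+ _ _ _] := nonleaf_cut y; rewrite in_inc => /andP[].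
have qc (u : LCvert star_alpha) : copy_edge u \in cross D.
  by have := copy_edgeP u; rewrite in_inc => /andP[].
(* The two kinds of crossing edges differ in their end in [D], which is wide for one and not for the
   other. *)
have yq (y : E2 star_graph) (u : LCvert star_alpha) :
    cut_of (pt (val y)) (val (val y).1) <> copy_edge u.
  move=> E; have [+ wy _ oD] := nonleaf_cut y; rewrite E in_inc => /andP[_ iy].
  have := copy_edgeP u; rewrite in_inc => /andP[_ iu].
  have cn := copy_narrow u; move: iu; rewrite (incidentE _ iy) => /orP[]/eqP uE.
    by move: wy; rewrite E /wide -uE cn cards1.
  by have := copy_out u; rewrite uE -E oD.
move=> [e|[y|q]] [e'|[y'|q']] /= E.
- by congr inl; apply: val_inj.
- by case: (Mc e _ (yc y') E).
- by case: (Mc e _ (qc _) E).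
- by case: (Mc e' _ (yc y) (esym E)).
- do 2!congr (_ _); apply: val_inj; apply: pt_inj.
  have [+ _ _ oD] := nonleaf_cut y; have [+ _ _ oD'] := nonleaf_cut y'.
  rewrite -E in oD' *; rewrite !in_inc => /andP[_ i'] /andP[_ i].
  move: i'; rewrite (incidentE _ i) => /orP[/eqP-> // | /eqP E'].
  by have := pt_outside (val y'); rewrite E' oD.
- by case: (yq _ _ E).
- by case: (Mc e' _ (qc _) (esym E)).
- by case: (yq _ _ (esym E)).
do 2!congr (_ _); case: q q' E => [[u x] q] [[u' x'] q'] /= /copy_edge_inj uu.
apply: val_inj => /=; congr (_, _) => //; apply: pt_inj.
have ptv (u0 : LCvert star_alpha) x0 : tail x0 == val (tag u0) -> pt x0 = val (val (tag u0)).
  move/eqP=> E0; have uD := copy_out u0; rewrite -E0 val_tail in uD *.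
  by rewrite centre_outside ?pt_outside.
by rewrite (ptv u x q) (ptv u' x' q') uu.
Qed.

Lemma S2_edge_inv_surj e : exists a, S2_edge_inv a = e.
Proof.
case/orP: (minimal_edgeP minG e DM) => [eM|eD]; first by exists (inl (exist _ e eM)).
have [d [dD ed]] : exists d, d \in D /\ e \in cuts d.
  have := eD; rewrite (in_cross _ (incident1 e)); case: (boolP ((endpts e).1 \in D)) => [dD _|_ /= dD].
    by exists (endpts e).1; rewrite in_inc eD incident1.
  by exists (opp e (endpts e).1); rewrite in_inc eD incident_opp ?incident1.
have := ed; rewrite in_inc => /andP[_ ev].
have [wd|nd] := boolP (wide d); last first.
  have [u [uv ue]] := narrow_copy dD ed nd; have [x xp] := pt_surj (opp_out dD ed).
  have q : tail x == val (tag u).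
    by rewrite -(inj_eq val_inj) val_tail xp -uv star_out ?copy_out.
  by exists (inr (inr (exist _ (u, x) q : E3 star_alpha))).
have [x xp] := pt_surj (opp_out dD ed).
have lx : ~~ leaf (tail x) by rewrite star_leaf val_tail xp centre_wide ?negbK.
exists (inr (inl (exist _ x lx))) => /=.
by apply/set1P; rewrite -(wide_other wd eD ev) -xp cut_ofP.
Qed.

Lemma S2_iso : iso (S2 star_alpha) G.
Proof.
exists S2_vert_inv, S2_edge_inv; split.
- exact: inj_surj_bij S2_vert_inv_inj S2_vert_inv_surj.
- exact: inj_surj_bij S2_edge_inv_inj S2_edge_inv_surj.
have ends e v : incident e v -> endpts e = (opp e v, v) \/ endpts e = (v, opp e v).
  rewrite /incident /opp; case: (endpts e) => a b /=.
  by have [<-|_ /= /eqP<-] := eqVneq a v; [right|left].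
move=> [e|[y|[[u x] q]]].
- by left; rewrite /= -surjective_pairing.
- have [+ _ cE oD] := nonleaf_cut y; rewrite in_inc => /andP[_ ev].
  have := ends _ _ ev; rewrite -cE.
  by case: y {cE oD ev} => x hx /=; rewrite -val_tail.
have := copy_edgeP u; rewrite in_inc => /andP[_ ev] /=; have := ends _ _ ev.
suff -> : pt x = val (val (tag u)) by [].
have E0 : tail x = val (tag u) by apply/eqP.
have uD := copy_out u; rewrite -E0 val_tail in uD *.
by rewrite centre_outside ?pt_outside.
Qed.

End Stars.

(** * The canonical pair of a subdivision *)

Section Subdivision.
Variables (H : mgraph) (alpha : vert H -> nat).
Hypothesis isoH : no_isolated H.
Notation K := (S2 alpha).

Definition S2_middle : {set edge K} := [set a : edge K | if a is inl _ then true else false].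

Lemma S2_new_setC : S2_new alpha = ~: S2_old alpha.
Proof. by apply/setP=> -[x|x]; rewrite !inE. Qed.

Lemma exists_dart (v : vert H) : exists x : edge H * bool, tail x = v.
Proof.
have /set0Pn[x] : [set x : edge H * bool | tail x == v] != set0.
  by rewrite -cards_eq0 -deg_darts.
by rewrite inE => /eqP; exists x.
Qed.

Definition nonleaf_edge x (hx : ~~ leaf (tail x)) : edge K := inr (inl (exist _ x hx)).
Definition copy_link (u : LCvert alpha) x (ux : tail x == val (tag u)) : edge K :=
  inr (inr (exist (fun p : LCvert alpha * (edge H * bool) => endside p.2.1 p.2.2 == val (tag p.1))
              (u, x) ux)).

Lemma S2_DPset : (forall v : vert H, leaf v -> 0 < alpha v) ->
  DPset (S2_old alpha : {set vert K}) S2_middle.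
Proof.
move=> al; split.
- by case=> [e _|a]; [apply/eqP; case | rewrite inE].
- by case=> [e|[y|q]] v; rewrite inE // => _ /orP[]/eqP <-; rewrite inE.
- case=> [[v|u]|[e b]]; rewrite inE // => _.
  apply/eqP/cards1P; exists (inl e); apply/setP=> -[e'|a]; rewrite !inE // /incident /=.
  rewrite ![inr _ == inr _]/eq_op /= !xpair_eqE [inl _ == inl _]/eq_op /=.
  by case: b; rewrite ?andbT ?andbF ?orbF.
case=> [[v|u]|x]; apply/set0Pn.
- have [x xv] := exists_dart (val v); have hx : ~~ leaf (tail x) by rewrite xv (valP v).
  exists (nonleaf_edge hx); rewrite !inE /incident /=; apply/orP; left; apply/eqP.
  by do 2!congr inl; apply: val_inj.
- have [x /eqP xu] := exists_dart (val (tag u)).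
  by exists (copy_link xu); rewrite !inE; apply: incident1 (copy_link xu).
have [lx|nx] := boolP (leaf (tail x)); last first.
  by exists (nonleaf_edge nx); rewrite !inE; apply: incident2 (nonleaf_edge nx).
pose u : LCvert alpha := existT _ (exist (fun v => leaf v) _ lx) (Ordinal (al _ lx)).
have ux : tail x == val (tag u) by [].
by exists (copy_link ux); rewrite !inE; apply: incident2 (copy_link ux).
Qed.

(** Contracts every edge between an old and a new vertex, so that the middle edges become the edges
    of [H]. *)
Definition S2_proj (v : vert K) : vert H :=
  match v with
  | inl (inl v) => val v
  | inl (inr u) => val (tag u)
  | inr x => tail x
  end.

Lemma S2_connected : connected K -> connected H.
Proof.
move=> conK; have step (a : edge K) : connect (@adj H) (S2_proj (endpts a).1) (S2_proj (endpts a).2)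
    /\ connect (@adj H) (S2_proj (endpts a).2) (S2_proj (endpts a).1).
  case: a => [e|[[y hy]|[[u x] /= q]]] /=; last by rewrite /tail /= (eqP q); split; apply: connect0.
    have := surjective_pairing (endpts e) => /eqP ee.
    by split; apply/connect1/existsP; exists e; rewrite ee ?orbT.
  by split; apply: connect0.
have surj v : exists w : vert K, S2_proj w = v.
  by have [x xv] := exists_dart v; exists (inr x).
move=> u v; have [u' <-] := surj u; have [v' <-] := surj v.
have /connectP[p] := conK u' v'; elim: p u' => [w _ -> //|x p IHp w /= /andP[/existsP[a wx] xp] lp].
apply: connect_trans (IHp _ xp lp); have [s1 s2] := step a.
by case/orP: wx => /eqP E; rewrite E in s1 s2.
Qed.

(** Every edge is forced: a middle edge by the matching, an edge at a non-leaf as the only crossing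
    edge at its new end, and an edge at a copy because copies are pendant. *)
Lemma S2_old_full (F : {set edge K}) (M : {set edge (restrict F)}) :
  DPset (S2_old alpha : {set vert (restrict F)}) M -> F = [set: edge K].
Proof.
move=> DM; apply/setP=> a; rewrite in_setT.
have ends (b : edge (restrict F)) v : incident b v =
  ((endpts (val b)).1 == v) || ((endpts (val b)).2 == v) by [].
have cr (b : edge (restrict F)) : b \in cross (S2_old alpha : {set vert (restrict F)}) =
  if val b is inl _ then false else true.
  by case: b => b bF; rewrite !inE /=; case: b bF => [|[[]|[]]].
case: a => [e|[y|q]].
- have eD : (inr (e, true) : vert (restrict F)) \notin (S2_old alpha : {set vert (restrict F)}).
    by rewrite inE.
  have /eqP/cards1P[b Mb] := DPset_matched DM eD; have [bM be] := inc1_mem Mb.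
  have := matching_not_cross DM bM; rewrite cr; move: be; rewrite ends.
  case: b {Mb bM} => -[e'|//] bF /= /orP[]/eqP[] //.
  by move=> <-.
- have /set0Pn[b] := DPset_cross DM (inr (val y) : vert (restrict F)).
  rewrite in_inc cr ends; case: b => -[//|[[y' hy']|[[u x] q]]] bF /= /eqP [E].
    suff -> : y = exist _ y' hy' by [].
    by apply: val_inj.
  have xy : x = val y := E; have := valP y; rewrite -xy; move: (q) => /= /eqP ->.
  by rewrite (valP (tag u)).
case: q => -[u x] q.
have /set0Pn[b] := DPset_cross DM (inl (inr u) : vert (restrict F)).
rewrite in_inc cr ends orbC; case: b => -[//|[[y' hy']|[[u' x'] q']]] bF //= /eqP [E].
suff -> : exist _ (u, x) q = exist _ (u', x') q' :> E3 alpha by [].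
subst u'; have := valP (tag u); rewrite /leaf deg_darts => /cards1P[z Ez].
have only w : tail w == val (tag u) -> w = z by move=> wu; apply/set1P; rewrite -Ez inE.
by apply: val_inj; rewrite /= (only x q) (only x' q').
Qed.

(** A DP-pair of a spanning subgraph is one of the whole graph, so by uniqueness it is the canonical
    pair, which uses all edges. *)
Lemma S2_unique_minimal : DP_pair (S2_old alpha) (S2_new alpha) ->
  (forall D P : {set vert K}, DP_pair D P -> D = S2_old alpha /\ P = S2_new alpha) ->
  minimal_DPDP K.
Proof.
move=> dp uniq; split=> [|F pF [D [_ /DP_pairP[_ [M DM]]]]]; first by exists (S2_old alpha), (S2_new alpha).
have DMK : DPset (D : {set vert K}) (val @: M).
  rewrite -(imset_id D); apply: (@DPset_hom (restrict F) K id val D M) DM; first by exists id.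
  by move=> e; left; exact: surjective_pairing.
have [|DE _] := uniq D (~: D); first by apply/DP_pairP; split=> //; exists (val @: M).
by subst D; move: pF; rewrite (S2_old_full DM) properxx.
Qed.

End Subdivision.

(** * Dichotomy and conclusion *)

Lemma minimal_unique_or_cycle (G : mgraph) : connected G -> vert G -> minimal_DPDP G ->
  (forall D1 D2 M1 M2, DPset D1 M1 -> DPset D2 M2 -> D1 = D2 :> {set vert G}) \/
  exists2 n, n \in [:: 3; 6; 9] & iso G (cycle_graph n).
Proof.
move=> conG v0 minG; case: (boolP [forall v : vert G, #|inc setT v| == 2]) => [/forallP two|].
  right; have [[D [_ /DP_pairP[_ [M DM]]]] _] := minG.
  (* Every edge is matched or crossing, and a loop is neither. *)
  have noloop (e : edge G) : (endpts e).1 != (endpts e).2.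
    case/orP: (minimal_edgeP minG e DM) => [/(DPset_loopless DM)//|].
    by rewrite inE; apply: contraTneq => ->; rewrite addbb.
  have two' (v : vert G) : #|[set x : edge G * bool | tail x == v]| = 2.
    by rewrite loopless_darts //; apply/eqP.
  have [n n0 isoC] := two_regular_cycle two' conG v0.
  by exists n => //; apply: minimal_cycle n0 (iso_minimal isoC minG).
(* A vertex not on exactly two edges rules out disjoint first sets, so any two pairs meet and
   coincide. *)
rewrite negb_forall => /existsP[v /eqP nv]; left=> D1 D2 M1 M2 DM1 DM2.
apply: (meeting_eq minG DM1 DM2 conG); apply: contra_notN nv; rewrite setI_eq0.
exact: disjoint_card DM1 DM2.
Qed.

Theorem theorem6p1 (G : mgraph) :
  connected G -> 3 <= #|vert G| ->
  (minimal_DPDP G <->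
   exists (H : mgraph) (alpha : vert H -> nat),
     [/\ connected H, no_isolated H,
         (forall v : vert H, leaf v -> 0 < alpha v),
         iso G (S2 alpha) &
         ((DP_pair (S2_old alpha) (S2_new alpha) /\
           forall D P : {set vert (S2 alpha)}, DP_pair D P ->
             D = S2_old alpha /\ P = S2_new alpha)
          \/ exists2 n, n \in [:: 3; 6; 9] & iso (S2 alpha) (cycle_graph n))]).
Proof.
move=> conG card3; split=> [minG | [H [alpha [_ isoH al isoK [[dp uniq]|[n n369 isoC]]]]]].
- have [[D [_ /DP_pairP[_ [M DM]]]] _] := minG.
  (* Any DP-pair of [G] will do: [H] is the contraction of its stars. *)
  pose H := star_graph DM; pose alpha := @star_alpha _ _ _ DM; exists H, alpha.
  have isoH : no_isolated H := @star_no_isolated _ _ _ DM.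
  have al (v : vert H) : leaf v -> 0 < alpha v by move=> _; apply: star_alpha_gt0.
  have isoGK : iso G (S2 alpha) := iso_sym (S2_iso minG DM).
  have conK := iso_connected isoGK conG.
  have minK := iso_minimal isoGK minG.
  have DMK := S2_DPset isoH al.
  split=> //; first exact: S2_connected isoH conK.
  have [v0 _] : exists v : vert G, v \in [set: vert G].
    by apply/set0Pn; rewrite -card_gt0 cardsT (leq_trans _ card3).
  have [f _] := isoGK.
  have [uniq|cyc] := minimal_unique_or_cycle conK (f v0) minK; [left | by right].
  split; first by apply/DP_pairP; split; [exact: S2_new_setC | exists (S2_middle alpha)].
  move=> D' P' /DP_pairP[-> [M' DM']]; rewrite S2_new_setC.
  by rewrite (uniq _ _ _ _ DM' DMK).
- exact: iso_minimal (iso_sym isoK) (S2_unique_minimal dp uniq).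
(* The canonical pair makes the cycle a DPDP-graph; the edge count of [cycle_minimal] then gives
   minimality, carried back to [G]. *)
have DPS2 : DPDP (S2 alpha).
  exists (S2_old alpha), (~: S2_old alpha); apply/DP_pairP; split=> //.
  by exists (S2_middle alpha); apply: S2_DPset.
have [f [g [bf _ fg]]] := isoC.
exact: iso_minimal (iso_sym (iso_trans isoK isoC)) (cycle_minimal n369 (DPDP_hom bf fg DPS2)).
Qed.
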